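(* Let $\mathbf{p}=(p_1,\dots,p_n)$ be a probability distribution, $Z>0$ an integer, and let $\Delta_g$ be the total variation divergence, $\Delta_g(\mathbf{p},\mathbf{M})=\frac12\sum_{i=1}^n\left|\frac{M_i}{Z}-p_i\right|$. Then every $\mathbf{M}\in\mathcal{M}[n,Z]$ that minimizes $\Delta_g(\mathbf{p},\cdot)$ over $\mathcal{M}[n,Z]$ satisfies $\lfloor Zp_i\rfloor\le M_i\le\lfloor Zp_i\rfloor+1$ for all $i=1,\dots,n$.
   Context: $\mathcal{M}[n,Z]:=\{(M_1,\dots,M_n)\in\mathbb{Z}_{\ge0}^n:\sum_iM_i=Z\}$; each $\mathbf{M}$ is identified with the distribution $(M_1/Z,\dots,M_n/Z)$. *)

(* Defs.v *)
From mathcomp Require Import all_boot all_order all_algebra.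
From mathcomp Require Import classical_sets reals.
Set Implicit Arguments.
Unset Strict Implicit.
Unset Printing Implicit Defensive.
Import Order.TTheory GRing.Theory Num.Theory.
Local Open Scope classical_set_scope.
Local Open Scope ring_scope.

Definition prob_distr (R : realType) (n : nat) (p : 'I_n -> R) : Prop :=
  (forall i, 0 <= p i) /\ \sum_(i < n) p i = 1.

Definition count_vectors (n Z : nat) : set ('I_n -> nat) :=
  [set M | (\sum_(i < n) M i)%N = Z].

Definition count_distr (R : realType) (n Z : nat) (M : 'I_n -> nat) : 'I_n -> R :=
  fun i => (M i)%:R / Z%:R.

Definition tv_div (R : realType) (n : nat) (p q : 'I_n -> R) : R :=
  2^-1 * \sum_(i < n) `|q i - p i|.

Definition minimizes_over (R : realType) (T : Type) (D : set T) (f : T -> R)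
    (x : T) : Prop :=
  D x /\ forall y, D y -> f x <= f y.

(* Main.v *)
Require Import Defs.
From mathcomp Require Import all_boot all_order all_algebra.
From mathcomp Require Import classical_sets reals.
From mathcomp Require Import zify lra.
Import Order.TTheory GRing.Theory Num.Theory.
Local Open Scope ring_scope.

(** Put [x_i := Z p_i], so that the [M_i] and the [x_i] have the same sum.
    If some [M_a] exceeds [x_a], then some [M_b] is below [x_b], and conversely.
    Moving one unit from [a] to [b] raises each of the two deviations by less
    than [1], and lowers one of them by exactly [1] as soon as [M_a - 1 >= x_a]
    or [M_b + 1 <= x_b]; a minimizer therefore satisfies neither. *)

(** Otherwise [f <= g] everywhere, strictly at [a], and the sums would differ. *)
Lemma sum_eq_exists_lt {R : realDomainType} {I : finType} {f g : I -> R} {a : I} :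
  \sum_i f i = \sum_i g i -> f a < g a -> exists b, g b < f b.
Proof.
move=> efg lt_a; apply/existsP; apply: contraT => /existsPn nlt.
have : \sum_i f i < \sum_i g i.
  rewrite (bigD1 a) //= [ltRHS](bigD1 a) //= ltr_leD // ler_sum // => i _.
  by rewrite leNgt nlt.
by rewrite efg ltxx.
Qed.

(** The predecessor is truncated: if [M a = 0] and [a != b], the total grows by one. *)
Definition move_unit {I : eqType} (M : I -> nat) (a b : I) : I -> nat :=
  fun i => if i == a then (M a).-1 else if i == b then (M b).+1 else M i.

(** A general [F] covers both the total count and the sum of deviations; the sum over untouched
    indices is isolated so that it cancels in comparisons. *)
Lemma sum_move_unit {V : nmodType} {I : finType} (F : I -> nat -> V)
    (M : I -> nat) {a b : I} : a != b ->
  \sum_i F i (move_unit M a b i) =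
  F a (M a).-1 + (F b (M b).+1 + \sum_(i | (i != a) && (i != b)) F i (M i)).
Proof.
move=> neq_ab; rewrite (bigD1 a) //= (bigD1 b) /= 1?eq_sym //.
rewrite /move_unit !eqxx eq_sym (negbTE neq_ab).
by do 2 congr (_ + _); apply: eq_bigr => i /andP[/negbTE -> /negbTE ->].
Qed.

Lemma sumD2 {V : nmodType} {I : finType} (F : I -> V) {a b : I} : a != b ->
  \sum_i F i = F a + (F b + \sum_(i | (i != a) && (i != b)) F i).
Proof. by move=> neq_ab; rewrite (bigD1 a) //= (bigD1 b) // eq_sym. Qed.

Lemma count_vectors_move_unit {n Z : nat} {M : 'I_n -> nat} {a b : 'I_n} :
  a != b -> (0 < M a)%N -> count_vectors Z M ->
  count_vectors Z (move_unit M a b).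
Proof.
rewrite /count_vectors /= => neq_ab Ma_gt0 <-.
have := sum_move_unit (fun=> id) M neq_ab; have := sumD2 M neq_ab.
rewrite /GRing.add /GRing.zero /= => -> ->; lia.
Qed.

(** With the positive factor taken out, minimality compares sums of deviations from [Z p_i]. *)
Lemma tv_div_count_distr {R : realType} {n Z : nat} (p : 'I_n -> R)
    (N : 'I_n -> nat) : (0 < Z)%N ->
  tv_div p (count_distr R Z N) =
  (2 * Z%:R)^-1 * \sum_i `|(N i)%:R - Z%:R * p i|.
Proof.
move=> Z_gt0; have Z0 : 0 < Z%:R :> R by rewrite ltr0n.
rewrite /tv_div /count_distr invfM -mulrA; congr (_ * _).
rewrite mulr_sumr; apply: eq_bigr => i _.
rewrite -{2}(gtr0_norm Z0) -normfV -normrM mulrBr mulKf ?gt_eqF //.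
by rewrite [_^-1 * _]mulrC.
Qed.

Section Minimizer.

Context {R : realType} {n Z : nat} {p : 'I_n -> R} {M : 'I_n -> nat}.
Hypotheses (p_ge0 : forall i, 0 <= p i) (Z_gt0 : (0 < Z)%N).
Hypothesis minM : minimizes_over (@count_vectors n Z)
  (fun N : 'I_n -> nat => tv_div p (count_distr R Z N)) M.

Lemma minimizer_deviations_lt1 {a b : 'I_n} :
  Z%:R * p a < (M a)%:R -> (M b)%:R < Z%:R * p b ->
  (M a)%:R < Z%:R * p a + 1 /\ Z%:R * p b < (M b)%:R + 1.
Proof.
move=> gt_a lt_b.
have neq_ab : a != b by apply: contraTneq lt_b => <-; rewrite -leNgt ltW.
have Ma_gt0 : (0 < M a)%N.
  by rewrite -(ltr0n R) (le_lt_trans _ gt_a) // mulr_ge0 ?ler0n.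
have [cM] := minM.
move=> /(_ _ (count_vectors_move_unit neq_ab Ma_gt0 cM)).
rewrite !tv_div_count_distr // ler_pM2l ?invr_gt0 ?mulr_gt0 ?ltr0n //.
rewrite (sum_move_unit (fun i k => `|k%:R - Z%:R * p i|)) //.
rewrite (sumD2 _ neq_ab) !addrA lerD2r.
have -> : (M a).-1%:R = (M a)%:R - 1 :> R by rewrite -subn1 natrB.
rewrite -[(M b).+1%:R]natr1 (gtr0_norm (x := _ - _)) ?subr_gt0 //.
rewrite (ltr0_norm (x := (M b)%:R - _)) ?subr_lt0 //.
(* If [M a - 1 >= Z p_a] or [M b + 1 >= Z p_b] fails to change sign strictly, minimality decides;
   this includes the boundary [Z p_b = M b + 1], where the deviation at [b] drops by exactly 1. *)
by case: ger0P => ?; case: ger0P => ?; lra.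
Qed.

End Minimizer.

Theorem theoremB2 (R : realType) (n Z : nat) (p : 'I_n -> R)
    (hp : prob_distr p) (hZ : (0 < Z)%N) (M : 'I_n -> nat)
    (hM : minimizes_over (@count_vectors n Z)
            (fun N : 'I_n -> nat => tv_div p (count_distr R Z N)) M) :
  forall i : 'I_n,
    Num.floor (Z%:R * p i) <= (M i)%:Z <= Num.floor (Z%:R * p i) + 1.
Proof.
move=> i; have [p_ge0 sum_p] := hp.
have sumM : \sum_j Z%:R * p j = \sum_j (M j)%:R.
  by have [sM _] := hM; rewrite -mulr_sumr sum_p mulr1 -natr_sum sM.
apply/andP; split.
  (* For integers the lower bound amounts to the strict [Z p_i < M i + 1]. *)
  rewrite -ltzD1 floor_lt_int intrD.
  have [le_i|gt_i] := lerP (Z%:R * p i) (M i)%:R; first by rewrite ltr_pwDr.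
  have [a gt_a] := sum_eq_exists_lt (esym sumM) gt_i.
  by have [] := minimizer_deviations_lt1 p_ge0 hZ hM gt_a gt_i.
(* The upper bound only needs the weak [M i - 1 <= Z p_i]. *)
rewrite -lerBlDr floor_ge_int intrB.
have [le_i|gt_i] := lerP (M i)%:R (Z%:R * p i).
  by rewrite lerBlDr (le_trans le_i) // lerDl.
have [b lt_b] := sum_eq_exists_lt sumM gt_i.
have [lt_i _] := minimizer_deviations_lt1 p_ge0 hZ hM gt_i lt_b.
by rewrite lerBlDr ltW.
Qed.
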